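(* There exists a nearring $(N,+,\cdot)$ that is zero-symmetric, simple, has an identity, and is not equiprime.
   Context: A (right) nearring is a triple $(N,+,\cdot)$ where $(N,+)$ is a (not necessarily abelian) group with neutral element $0$, $(N,\cdot)$ is a semigroup, and $(a+b)\cdot c=a\cdot c+b\cdot c$ for all $a,b,c\in N$. Products are also written by juxtaposition. A nearring $N$ is zero-symmetric if $0a=a0=0$ for all $a\in N$. It has an identity if there is $1\in N$ with $1a=a1=a$ for all $a\in N$. An ideal of $N$ is the kernel of a nearring homomorphism defined on $N$; $N$ is simple if its only ideals are $\{0\}$ and $N$. A nearring $N$ is equiprime if, whenever $a,x,y\in N$ satisfy $anx=any$ for all $n\in N$, then $a=0$ or $x=y$. *)

(* Defs.v *)
From HB Require Import structures.
From mathcomp Require Import all_boot.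

Set Implicit Arguments.
Unset Strict Implicit.
Unset Printing Implicit Defensive.

Local Open Scope group_scope.
Local Open Scope ring_scope.

(* MathComp writes groups multiplicatively unless they are abelian (zmodType).
   Here the additive notation 0, +, - comes from baseZmodType, which provides
   the operations without any law, in particular without commutativity; the
   product * is that of magmaType (in group_scope), also without laws. Neither
   structure requires a choiceType carrier. *)
HB.mixin Record isNearring N of Algebra.BaseZmodule N & Magma N := {
  nr_addA : forall x y z : N, x + (y + z) = x + y + z;
  nr_add0r : forall x : N, 0 + x = x;
  nr_addr0 : forall x : N, x + 0 = x;
  nr_addNr : forall x : N, - x + x = 0;
  nr_addrN : forall x : N, x + - x = 0;
  nr_mulA : forall x y z : N, x * (y * z) = x * y * z;
  nr_mulDl : forall a b c : N, (a + b) * c = a * c + b * c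
}.

#[short(type="nearringType")]
HB.structure Definition Nearring := {N of isNearring N & Algebra.BaseZmodule N & Magma N}.

Definition zero_symmetric (N : nearringType) : Prop :=
  forall a : N, 0 * a = 0 /\ a * 0 = 0.

Definition has_identity (N : nearringType) : Prop :=
  exists e : N, forall a : N, e * a = a /\ a * e = a.

(* Homomorphisms are not required to preserve an identity. *)
Definition nearring_morphism (N M : nearringType) (f : N -> M) : Prop :=
  {morph f : x y / x + y >-> x + y} /\ {morph f : x y / x * y >-> x * y}.

Definition is_ideal (N : nearringType) (I : N -> Prop) : Prop :=
  exists (M : nearringType) (f : N -> M),
    nearring_morphism f /\ forall x : N, I x <-> f x = 0.

Definition simple_nearring (N : nearringType) : Prop :=
  forall I : N -> Prop, is_ideal I ->
    (forall x : N, I x <-> x = 0) \/ (forall x : N, I x).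

Definition equiprime (N : nearringType) : Prop :=
  forall a x y : N, (forall n : N, a * n * x = a * n * y) -> a = 0 \/ x = y.

(* Main.v *)
Require Import Defs.
From HB Require Import structures.
From mathcomp Require Import all_boot.
From mathcomp Require Import all_algebra boolp.

(** Let K be a field with an element v different from 0 and 1, and let G be the
    additive group of K[X]. The nearring is the centralizer N of a monoid of
    injective endomorphisms of G: it consists of all maps f : G -> G commuting
    with multiplication by X and with every scale0 u (u <> 0), the automorphism
    that multiplies the constant coefficient by u; the product is composition.

    Two facts about this monoid matter. Every nonzero polynomial is uniquely
    q * X^i with q(0) <> 0, and scale0 u fixes everything divisible by X. So
    an element of N is the same thing as an arbitrary scale0-equivariant map on
    the polynomials with nonzero constant coefficient (emap_ext, extend_map):
    N contains very many maps, and none but 0 vanishes on the submodule X K[X],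
    although that submodule is invariant under N.

    N is not equiprime. The element rise takes its values in X K[X], where
    scale0 v is the identity, whereas twist v acts as scale0 v on polynomials
    with nonzero constant coefficient. As the elements n of N commute with
    scale0 v, rise * n * twist v = rise * n (rise_twist), but twist v <> 1.

    N is simple. If b <> 0 lies in an ideal, composing with suitable elements on
    both sides produces in the ideal a map c that is constantly X^J, J > 0, on
    the polynomials with nonzero constant coefficient (rise_focus). There are
    then n, m in N with n * m = 0 and n * (m + c) = 1: adding X^J to the values
    of m moves them into a region where n is free to invert m (fill_gap,
    fill_gap_shift). Modulo the ideal m + c and m agree, so 1 is in the ideal. *)

Set Implicit Arguments.
Unset Strict Implicit.
Unset Printing Implicit Defensive.

Import GRing.Theory.

Local Open Scope ring_scope.

(** * Kernels of nearring homomorphisms *)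

Lemma nearring_idem0 (N : nearringType) (x : N) : x = x + x -> x = 0.
Proof.
by move=> e; have := nr_addNr x; rewrite {2}e nr_addA nr_addNr nr_add0r.
Qed.

Section Kernels.
Variables (N M : nearringType) (f : N -> M).
Hypothesis f_morph : nearring_morphism f.

Lemma nearring_morph0 : f 0 = 0.
Proof.
by have [fD _] := f_morph; apply: nearring_idem0; rewrite -fD nr_add0r.
Qed.

Lemma kernel_mulr b c : f b = 0 -> f (b * c)%g = 0.
Proof.
have [_ fM] := f_morph => fb0; rewrite fM fb0.
by apply: nearring_idem0; rewrite -nr_mulDl nr_add0r.
Qed.

(** The values n * (m + b) and n * m have the same image when b is in the
    kernel. With m = 0 this gives closure under left multiplication, provided
    n * 0 = 0; the latter cannot be asked of the target. *)
Lemma kernel_shift n m b : (n * m)%g = 0 -> f b = 0 -> f (n * (m + b))%g = 0.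
Proof.
have [fD fM] := f_morph => nm0 fb0.
by rewrite fM fD fb0 nr_addr0 -fM nm0 nearring_morph0.
Qed.

End Kernels.

(** * Scaling of the constant coefficient *)

Section EquivariantMaps.
Variable K : fieldType.
Implicit Types (p q : {poly K}) (u v : K).

Definition scale0 u p : {poly K} := p + ((u - 1) * p`_0)%:P.

Lemma coef_scale0 u p i : (scale0 u p)`_i = if i == 0%N then u * p`_0 else p`_i.
Proof.
by rewrite !coefE; case: eqP => [->|_]; rewrite ?addr0 // mulrBl mul1r subrKC.
Qed.

Lemma scale0D u : {morph scale0 u : p q / p + q}.
Proof. by move=> p q; rewrite /scale0 coefD mulrDr polyCD addrACA. Qed.

Lemma scale0N u : {morph scale0 u : p / - p}.
Proof. by move=> p; rewrite /scale0 coefN mulrN polyCN opprD. Qed.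

Lemma scale0_0 u : scale0 u 0 = 0.
Proof. by rewrite /scale0 coef0 mulr0 addr0. Qed.

Lemma scale0_id u p : p`_0 = 0 -> scale0 u p = p.
Proof. by rewrite /scale0 => ->; rewrite mulr0 addr0. Qed.

Lemma scale0M u v p : scale0 (u * v) p = scale0 u (scale0 v p).
Proof. by apply/polyP => i; rewrite !coef_scale0; case: eqP; rewrite ?mulrA. Qed.

Lemma poly_level p : p != 0 -> exists q i, q`_0 != 0 /\ p = q * 'X^i.
Proof.
elim/poly_ind: p => [|p c IH]; first by rewrite eqxx.
have [->|c0 _] := eqVneq c 0.
  rewrite addr0 mulf_eq0 polyX_eq0 orbF => /IH[q [i [q0 ->]]].
  by exists q, i.+1; rewrite exprSr mulrA.
by exists (p * 'X + c%:P), 0%N; rewrite !coefE add0r mulr1.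
Qed.

(** * Maps commuting with multiplication by X and with scalings *)

Record equivMap := EquivMap {
  emap :> {poly K} -> {poly K};
  emapX : forall p, emap (p * 'X) = emap p * 'X;
  emap_scale0 : forall u p, u != 0 -> emap (scale0 u p) = scale0 u (emap p)
}.

(** f 0 is divisible by X and equal to its own product with X. *)
Lemma emap0 (f : equivMap) : f 0 = 0.
Proof.
have := emapX f 0; rewrite mul0r => /eqP; rewrite -subr_eq0 -{1}[f 0]mulr1 -mulrBr.
rewrite mulf_eq0 => /orP[/eqP//|/eqP/polyP/(_ 0%N)/eqP].
by rewrite !coefE subr0 oner_eq0.
Qed.

Lemma emapXn (f : equivMap) p i : f (p * 'X^i) = f p * 'X^i.
Proof. by elim: i => [|i IH]; rewrite ?mulr1 // exprSr !mulrA emapX IH. Qed.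

(** A nonzero polynomial is q * X^i with q(0) <> 0, and f (q * X^i) is
    f q * X^i. *)
Lemma emap_ext (f g : equivMap) : (forall p, p`_0 != 0 -> f p = g p) -> f = g.
Proof.
move=> fg; have {fg} : f = g :> (_ -> _).
  apply: funext => p; have [->|/poly_level[q [i [q0 ->]]]] := eqVneq p 0.
    by rewrite !emap0.
  by rewrite !emapXn fg.
case: f g => [f fX fs] [g gX gs] /= e; case: _ / e in gX gs *.
by congr EquivMap; exact: Prop_irrelevance.
Qed.

Section Extension.
Variable h : {poly K} -> {poly K}.

(** On coefficient sequences, the map sending q * X^i to h q * X^i whenever
    q(0) <> 0. *)
Fixpoint extend_seq (s : seq K) : {poly K} :=
  if s is c :: s' then if c == 0 then extend_seq s' * 'X else h (Poly s) else 0.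

Definition extend p := extend_seq p.

Lemma extendE p : p`_0 != 0 -> extend p = h p.
Proof.
rewrite /extend -{3}(polyseqK p); case: (polyseq p) => [|c s] /=.
  by rewrite eqxx.
by move/negPf->.
Qed.

Lemma extendX p : extend (p * 'X) = extend p * 'X.
Proof.
have [->|p0] := eqVneq p 0; first by rewrite /extend mul0r polyseq0 /= mul0r.
by rewrite /extend polyseqMX //= eqxx.
Qed.

Hypothesis h_scale0 :
  forall u p, u != 0 -> p`_0 != 0 -> h (scale0 u p) = scale0 u (h p).

(** Equivariance of h is needed only when p(0) <> 0: otherwise p and its image
    are both divisible by X, and scale0 u fixes them. *)
Lemma extend_scale0 u p : u != 0 -> extend (scale0 u p) = scale0 u (extend p).
Proof.
move=> u0; have [p0|p0] := eqVneq p`_0 0; last first.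
  by rewrite !extendE ?coef_scale0 ?mulf_neq0 // h_scale0.
have -> : p = (\poly_(i < size p) p`_i.+1) * 'X.
  apply/polyP => -[|i]; rewrite coefMX //= coef_poly.
  by case: ltnP => // le_p_i; rewrite nth_default // leqW.
by rewrite scale0_id ?coefMX // extendX [RHS]scale0_id // coefMX.
Qed.

Definition extend_map := EquivMap extendX extend_scale0.

End Extension.

(** * The nearring structure *)

Fact add_subproof_X (f g : equivMap) p :
  f (p * 'X) + g (p * 'X) = (f p + g p) * 'X.
Proof. by rewrite !emapX mulrDl. Qed.

Fact add_subproof_scale0 (f g : equivMap) u p : u != 0 ->
  f (scale0 u p) + g (scale0 u p) = scale0 u (f p + g p).
Proof. by move=> u0; rewrite !emap_scale0 // scale0D. Qed.

Fact opp_subproof_X (f : equivMap) p : - f (p * 'X) = - f p * 'X.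
Proof. by rewrite emapX mulNr. Qed.

Fact opp_subproof_scale0 (f : equivMap) u p : u != 0 ->
  - f (scale0 u p) = scale0 u (- f p).
Proof. by move=> u0; rewrite emap_scale0 // scale0N. Qed.

Fact zero_subproof_X p : 0 = 0 * 'X :> {poly K}.
Proof. by rewrite mul0r. Qed.

Fact zero_subproof_scale0 u p : u != 0 -> 0 = scale0 u 0.
Proof. by rewrite scale0_0. Qed.

Fact comp_subproof_X (f g : equivMap) p : f (g (p * 'X)) = f (g p) * 'X.
Proof. by rewrite !emapX. Qed.

Fact comp_subproof_scale0 (f g : equivMap) u p : u != 0 ->
  f (g (scale0 u p)) = scale0 u (f (g p)).
Proof. by move=> u0; rewrite !emap_scale0. Qed.

Definition id_map : equivMap :=
  @EquivMap id (fun _ => erefl) (fun _ _ _ => erefl).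

HB.instance Definition _ := Algebra.hasAdd.Build equivMap
  (fun f g => EquivMap (add_subproof_X f g) (add_subproof_scale0 f g)).
HB.instance Definition _ := Algebra.hasZero.Build equivMap
  (EquivMap zero_subproof_X zero_subproof_scale0).
HB.instance Definition _ := Algebra.hasOpp.Build equivMap
  (fun f => EquivMap (opp_subproof_X f) (opp_subproof_scale0 f)).
HB.instance Definition _ := hasMul.Build equivMap
  (fun f g => EquivMap (comp_subproof_X f g) (comp_subproof_scale0 f g)).

Fact equivMap_addA (f g h : equivMap) : f + (g + h) = f + g + h.
Proof. by apply: emap_ext => p _; exact: addrA. Qed.
Fact equivMap_add0r (f : equivMap) : 0 + f = f.
Proof. by apply: emap_ext => p _; exact: add0r. Qed.
Fact equivMap_addr0 (f : equivMap) : f + 0 = f.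
Proof. by apply: emap_ext => p _; exact: addr0. Qed.
Fact equivMap_addNr (f : equivMap) : - f + f = 0.
Proof. by apply: emap_ext => p _; exact: addNr. Qed.
Fact equivMap_addrN (f : equivMap) : f + - f = 0.
Proof. by apply: emap_ext => p _; exact: addrN. Qed.
Fact equivMap_mulA (f g h : equivMap) : (f * (g * h) = f * g * h)%g.
Proof. exact: emap_ext. Qed.
Fact equivMap_mulDl (f g h : equivMap) : ((f + g) * h)%g = (f * h)%g + (g * h)%g.
Proof. exact: emap_ext. Qed.

HB.instance Definition _ := isNearring.Build equivMap
  equivMap_addA equivMap_add0r equivMap_addr0 equivMap_addNr equivMap_addrN
  equivMap_mulA equivMap_mulDl.

Lemma equivMap_zero_symmetric : zero_symmetric equivMap.
Proof.
by move=> f; split; apply: emap_ext => p _ //; exact: emap0.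
Qed.

Lemma equivMap_has_identity : has_identity equivMap.
Proof. by exists id_map => f; split; exact: emap_ext. Qed.

(** * Failure of equiprimeness *)

Fact rise_scale0 u p : u != 0 -> p`_0 != 0 -> 'X = scale0 u 'X.
Proof. by rewrite scale0_id ?coefX. Qed.

(** The map sending q * X^i, with q(0) <> 0, to X^(i + 1). It forgets everything
    but the order of vanishing, and its values are fixed by all scalings. *)
Definition rise := extend_map rise_scale0.

Lemma riseE p i : p`_0 != 0 -> rise (p * 'X^i) = 'X^(i.+1).
Proof. by move=> p0; rewrite emapXn /= extendE // exprS. Qed.

Lemma rise_coef0 p : (rise p)`_0 = 0.
Proof.
have [->|/poly_level[q [i [q0 ->]]]] := eqVneq p 0.
  by rewrite emap0 coef0.
by rewrite riseE // coefXn.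
Qed.

Fact twist_scale0 v u p : u != 0 -> p`_0 != 0 ->
  scale0 v (scale0 u p) = scale0 u (scale0 v p).
Proof. by rewrite -!scale0M mulrC. Qed.

(** This multiplies the lowest nonzero coefficient by v. Unlike scale0 v, which
    fixes the multiples of X, it commutes with multiplication by X. *)
Definition twist v := extend_map (twist_scale0 v).

(** On polynomials with nonzero constant coefficient twist v is scale0 v, which
    moves past f and past rise and then acts trivially on a value of rise. *)
Lemma rise_twist v (f : equivMap) : v != 0 ->
  (rise * f * twist v = rise * f * id_map)%g.
Proof.
move=> v0; apply: emap_ext => p p0; change (rise (f (twist v p)) = rise (f p)).
by rewrite [twist v p]extendE // !emap_scale0 // scale0_id // rise_coef0.
Qed.

Lemma equivMap_not_equiprime v : v != 0 -> v != 1 -> ~ equiprime equivMap.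
Proof.
move=> v0 v1 /(_ rise (twist v) id_map (fun n => rise_twist n v0)).
have one0 : (1 : {poly K})`_0 != 0 by rewrite coef1 oner_neq0.
case=> [/(congr1 (fun f : equivMap => f 1))|/(congr1 (fun f : equivMap => f 1))] /=.
  by rewrite extendE // => /eqP; rewrite polyX_eq0.
rewrite extendE // => /polyP/(_ 0%N); rewrite coef_scale0 coef1 /= mulr1.
exact/eqP.
Qed.

(** * Simplicity *)

Fact focus_scale0 q u p : u != 0 -> p`_0 != 0 ->
  scale0 (scale0 u p)`_0 q = scale0 u (scale0 p`_0 q).
Proof. by rewrite -scale0M coef_scale0. Qed.

(** This collapses all polynomials with nonzero constant coefficient onto the
    scalings of q; it is the closest an element of the nearring can be to the
    constant map q. *)
Definition focus q := extend_map (focus_scale0 q).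

(** If b q = r * X^J with r(0) <> 0, then b * focus q takes only scalings of
    r * X^J as values, and rise sends all of these to X^(J + 1). *)
Lemma rise_focus (b : equivMap) : b <> 0 ->
  exists q J, forall p, p`_0 != 0 ->
    (rise * (b * focus q))%g p = 'X^(J.+1).
Proof.
move=> b0.
have [q bq] : exists q, b q != 0.
  apply: contrapT => /forallNP b_eq0; apply: b0; apply: emap_ext => p _.
  by apply/eqP/negP => /negP/b_eq0.
have [r [J [r0 br]]] := poly_level bq; exists q, J => p p0.
change (rise (b (focus q p)) = 'X^(J.+1)).
rewrite [focus q p]extendE // !emap_scale0 // scale0_id ?rise_coef0 //.
by rewrite br riseE.
Qed.

Section Separation.
Variable J : nat.

(** gap sends p_0 + p_1 X + p_2 X^2 + ... to p_0 + p_1 X^(J + 2) +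
    p_2 X^(J + 3) + ..., which leaves the coefficient of X^(J + 1) free to record
    whether X^(J + 1) was added. When it was, fill undoes both steps; the
    truncation then turns the added X^(J + 1) into the constant 1, which is
    subtracted. *)
Definition gap p : {poly K} := (p`_0)%:P + (p - (p`_0)%:P) * 'X^(J.+1).
Definition fill p : {poly K} :=
  if p`_J.+1 == 1 then drop_poly J.+1 p + (p`_0 - 1)%:P else 0.

Fact gap_scale0 u p : u != 0 -> p`_0 != 0 -> gap (scale0 u p) = scale0 u (gap p).
Proof.
move=> _ _; apply/polyP => i; rewrite coef_scale0 /gap.
rewrite coef_scale0 !coefE /=; case: i => [|i] /=; first by rewrite !addr0.
rewrite !ltnS; case: ltnP => // _.
by case: eqP => [->|_]; rewrite ?addr0 // mulrBl mul1r subrKC !subrr.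
Qed.

Fact fill_scale0 u p : u != 0 -> p`_0 != 0 -> fill (scale0 u p) = scale0 u (fill p).
Proof.
move=> _ _; rewrite /fill !coef_scale0 /=; case: eqP => [pJ|_]; last first.
  by rewrite scale0_0.
apply/polyP => i.
rewrite [RHS]coef_scale0 coefD coef_drop_poly coef_scale0 addnS /= !coefE.
by case: i => [|i]; rewrite ?add0n ?pJ ?subrKC // addnS.
Qed.

Definition gap_map := extend_map gap_scale0.
Definition fill_map := extend_map fill_scale0.

Lemma gap_coef0 p : (gap p)`_0 = p`_0.
Proof. by rewrite !coefE addr0. Qed.

Lemma gap_coefJ p : (gap p)`_J.+1 = 0.
Proof. by rewrite /gap !coefE /= ltnn subnn subrr addr0. Qed.

Lemma fill_gap : (fill_map * gap_map)%g = 0.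
Proof.
apply: emap_ext => p p0 /=; rewrite [extend gap p]extendE //.
by rewrite extendE ?gap_coef0 // /fill gap_coefJ eq_sym oner_eq0.
Qed.

Lemma fill_gap_shift (c : equivMap) : (forall p, p`_0 != 0 -> c p = 'X^(J.+1)) ->
  (fill_map * (gap_map + c)%R)%g = id_map.
Proof.
move=> cE; apply: emap_ext => p p0 /=; rewrite [extend gap p]extendE // cE //.
have E0 : (gap p + 'X^(J.+1))`_0 = p`_0 by rewrite coefD gap_coef0 coefXn addr0.
rewrite extendE ?E0 // /fill E0 coefD gap_coefJ coefXn eqxx add0r eqxx.
apply/polyP => i; rewrite !coefE addnS /= ltnS ltnNge leq_addl /=.
rewrite add0r subSS addnK eqSS -{2}[J]add0n eqn_add2r.
by case: i => [|i] /=; rewrite ?subrr ?add0r ?subrKC // subr0 !addr0.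
Qed.

End Separation.

(** Once the identity map is in the kernel, everything is. *)
Lemma equivMap_simple : simple_nearring equivMap.
Proof.
move=> I [M [f [f_morph IE]]].
have [[b [Ib b0]]|noI] := EM (exists b, I b /\ b <> 0); [right|left].
  have [q [J cE]] := rise_focus b0.
  set c := (rise * (b * focus q))%g in cE.
  have fc0 : f c = 0.
    have fbk0 : f (b * focus q)%g = 0 by apply: kernel_mulr => //; exact/IE.
    rewrite /c -[X in (_ * X)%g]equivMap_add0r; apply: kernel_shift => //.
    by have [] := equivMap_zero_symmetric rise.
  have f1 : f id_map = 0.
    by rewrite -(fill_gap_shift cE); apply: kernel_shift => //; exact: fill_gap.
  move=> x; apply/IE.
  have -> : x = (id_map * x)%g by exact: emap_ext.
  exact: kernel_mulr.
move=> x; split=> [Ix|->]; last by apply/IE; exact: nearring_morph0.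
by apply: contrapT => x0; apply: noI; exists x.
Qed.

End EquivariantMaps.

Theorem mainTheorem1 :
  exists N : nearringType,
    zero_symmetric N /\ simple_nearring N /\ has_identity N /\ ~ equiprime N.
Proof.
exists (equivMap rat); split; first exact: equivMap_zero_symmetric.
split; first exact: equivMap_simple.
split; first exact: equivMap_has_identity.
exact: (@equivMap_not_equiprime _ (-1)).
Qed.
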